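(* Let $A$ be a bijective skew $PBW$ extension of a ring $R$. If $R$ is a left Noetherian ring, then $A$ is also a left Noetherian ring.
   Context: Rings are associative with identity, not necessarily commutative; $\mathbb{N}=\{0,1,2,\dots\}$. Let $R$ and $A$ be rings. $A$ is a skew $PBW$ extension of $R$, written $A=\sigma(R)\langle x_1,\dots,x_n\rangle$, if: (i) $R\subseteq A$; (ii) there are finitely many elements $x_1,\dots,x_n\in A$ such that $A$ is a free left $R$-module with basis $\mathrm{Mon}(A):=\{x^\alpha=x_1^{\alpha_1}\cdots x_n^{\alpha_n}\mid \alpha=(\alpha_1,\dots,\alpha_n)\in\mathbb{N}^n\}$ (with $x_1^0\cdots x_n^0:=1$); (iii) for every $1\le i\le n$ and $r\in R-\{0\}$ there exists $c_{i,r}\in R-\{0\}$ such that $x_ir-c_{i,r}x_i\in R$; (iv) for every $1\le i,j\le n$ there exists $c_{i,j}\in R-\{0\}$ such that $x_jx_i-c_{i,j}x_ix_j\in R+Rx_1+\cdots+Rx_n$. Then for every $i$ there are an injective ring endomorphism $\sigma_i:R\to R$ (with $\sigma_i(r)=c_{i,r}$ for $r\neq 0$) and a $\sigma_i$-derivation $\delta_i:R\to R$ such that $x_ir=\sigma_i(r)x_i+\delta_i(r)$ for all $r\in R$. $A$ is called bijective if $\sigma_i$ is bijective for every $1\le i\le n$ and $c_{i,j}$ is invertible for all $1\le i<j\le n$. *)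

(* Defs.v *)
From HB Require Import structures.
From mathcomp Require Import all_boot all_algebra.
From mathcomp Require Import boolp.
Set Implicit Arguments.
Unset Strict Implicit.
Unset Printing Implicit Defensive.
Import GRing.Theory.
Local Open Scope ring_scope.

(* [pzRingType]: associative rings with identity, the zero ring included.
   Left ideals are Prop-valued, so that they need not be decidable. *)
Record left_ideal (R : pzRingType) (I : R -> Prop) : Prop := LeftIdeal {
  left_ideal0 : I 0;
  left_idealD : forall a b, I a -> I b -> I (a + b);
  left_idealM : forall r a, I a -> I (r * a)
}.

Definition left_noetherian (R : pzRingType) : Prop :=
  forall I : nat -> R -> Prop,
    (forall k, left_ideal (I k)) ->
    (forall k a, I k a -> I k.+1 a) ->
    exists N, forall k, (N <= k)%N -> forall a, I k a <-> I N a.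

Definition two_sided_invertible (R : pzRingType) (c : R) : Prop :=
  exists d, c * d = 1 /\ d * c = 1.

(* [A] is a left [R]-module through [iota], by [r . a := iota r * a]. *)
Definition left_basis (R A : pzRingType) (iota : {rmorphism R -> A})
    (T : eqType) (b : T -> A) : Prop :=
  (forall a : A, exists (s : seq T) (c : T -> R),
     a = \sum_(t <- s) iota (c t) * b t) /\
  (forall (s : seq T) (c : T -> R), uniq s ->
     \sum_(t <- s) iota (c t) * b t = 0 -> forall t, t \in s -> c t = 0).

(* The product is taken in increasing order of the index. *)
Definition monomial (A : pzRingType) (n : nat) (x : 'I_n -> A)
    (alpha : {ffun 'I_n -> nat}) : A :=
  \prod_(i < n) x i ^+ alpha i.

Definition var_coef_comm (R A : pzRingType) (iota : {rmorphism R -> A})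
    (n : nat) (x : 'I_n -> A) (i : 'I_n) (r c : R) : Prop :=
  c != 0 /\ exists d : R, x i * iota r - iota c * x i = iota d.

Definition var_var_comm (R A : pzRingType) (iota : {rmorphism R -> A})
    (n : nat) (x : 'I_n -> A) (i j : 'I_n) (c : R) : Prop :=
  c != 0 /\ exists (d : R) (e : 'I_n -> R),
    x j * x i - iota c * x i * x j = iota d + \sum_(k < n) iota (e k) * x k.

(* The inclusion of [R] in [A] is rendered by the ring embedding [iota]. *)
Record skew_PBW (R A : pzRingType) (iota : {rmorphism R -> A})
    (n : nat) (x : 'I_n -> A) : Prop := SkewPBW {
  skew_PBW_sub : injective iota;
  skew_PBW_basis : left_basis iota (monomial x);
  skew_PBW_var_coef : forall (i : 'I_n) (r : R), r != 0 ->
    exists c, var_coef_comm iota x i r c;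
  skew_PBW_var_var : forall i j : 'I_n, exists c, var_var_comm iota x i j c
}.

Definition skew_derivation (R : pzRingType) (sigma delta : R -> R) : Prop :=
  (forall r s, delta (r + s) = delta r + delta s) /\
  (forall r s, delta (r * s) = sigma r * delta s + delta r * s).

Record skew_PBW_endo (R A : pzRingType) (iota : {rmorphism R -> A})
    (n : nat) (x : 'I_n -> A) (i : 'I_n)
    (sigma : {rmorphism R -> R}) (delta : R -> R) : Prop := SkewPBWEndo {
  skew_PBW_endo_inj : injective sigma;
  skew_PBW_endo_deriv : skew_derivation sigma delta;
  skew_PBW_endoE : forall r,
    x i * iota r = iota (sigma r) * x i + iota (delta r)
}.

(* In a skew PBW extension [sigma_i] and [delta_i] exist and are unique
   (lemmas [skew_PBW_endo_exists] and [skew_PBW_endo_unique] below), and so is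
   the coefficient [c_{i,j}] for [i < j], because [x_i x_j], [1] and the [x_k]
   are then distinct basis elements.  The existential quantifiers below thus
   select these canonical data. *)
Record bijective_skew_PBW (R A : pzRingType) (iota : {rmorphism R -> A})
    (n : nat) (x : 'I_n -> A) : Prop := BijectiveSkewPBW {
  bijective_skew_PBW_skew : skew_PBW iota x;
  bijective_skew_PBW_endo : forall i : 'I_n,
    exists (sigma : {rmorphism R -> R}) (delta : R -> R),
      skew_PBW_endo iota x i sigma delta /\ bijective sigma;
  bijective_skew_PBW_coef : forall i j : 'I_n, (i < j)%N ->
    exists c, var_var_comm iota x i j c /\ two_sided_invertible c
}.

Lemma monomial0 (A : pzRingType) (n : nat) (x : 'I_n -> A) :
  monomial x [ffun=> 0%N] = 1.
Proof. by rewrite /monomial big1 // => i _; rewrite ffunE expr0. Qed.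

Lemma monomial1 (A : pzRingType) (n : nat) (x : 'I_n -> A) (i : 'I_n) :
  monomial x [ffun j => (j == i : nat)] = x i.
Proof.
have E (k : 'I_n) : x k ^+ [ffun j => (j == i : nat)] k =
    if k == i then x k else 1 by rewrite ffunE; case: eqP.
by rewrite /monomial (eq_bigr _ (fun k _ => E k)) -big_mkcond big_pred1_eq.
Qed.

Lemma skew_PBW_free1 (R A : pzRingType) (iota : {rmorphism R -> A})
    (n : nat) (x : 'I_n -> A) (i : 'I_n) (a b a' b' : R) :
  skew_PBW iota x ->
  iota a * x i + iota b = iota a' * x i + iota b' -> a = a' /\ b = b'.
Proof.
case=> _ [_ free] _ _ eq_ab.
pose u : {ffun 'I_n -> nat} := [ffun j => (j == i : nat)].
pose v : {ffun 'I_n -> nat} := [ffun=> 0%N].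
have uv : u != v by apply/eqP => /ffunP/(_ i); rewrite !ffunE eqxx.
pose c t := if t == u then a - a' else b - b'.
have c0 := free [:: u; v] c.
have cv : c v = b - b' by rewrite /c eq_sym (negbTE uv).
have cu : c u = a - a' by rewrite /c eqxx.
have {}c0 : forall t, t \in [:: u; v] -> c t = 0.
  apply: c0; first by rewrite /= inE uv.
  rewrite !big_cons big_nil addr0 cu cv monomial1 monomial0 mulr1 !rmorphB.
  by rewrite mulrBl addrACA eq_ab -opprD subrr.
split; apply/eqP; rewrite -subr_eq0; apply/eqP.
  by rewrite -cu c0 // inE eqxx.
by rewrite -cv c0 // !inE eqxx orbT.
Qed.

Lemma skew_PBW_endo_unique (R A : pzRingType) (iota : {rmorphism R -> A})
    (n : nat) (x : 'I_n -> A) (i : 'I_n) (s1 s2 : {rmorphism R -> R})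
    (d1 d2 : R -> R) :
  skew_PBW iota x -> skew_PBW_endo iota x i s1 d1 ->
  skew_PBW_endo iota x i s2 d2 -> s1 =1 s2 /\ d1 =1 d2.
Proof.
move=> pbw [_ _ E1] [_ _ E2].
have E r : s1 r = s2 r /\ d1 r = d2 r.
  by apply: (skew_PBW_free1 pbw (i := i)); rewrite -E1 -E2.
by split=> r; case: (E r).
Qed.

Lemma skew_PBW_endo_exists (R A : pzRingType) (iota : {rmorphism R -> A})
    (n : nat) (x : 'I_n -> A) (i : 'I_n) :
  skew_PBW iota x ->
  exists (sigma : {rmorphism R -> R}) (delta : R -> R),
    skew_PBW_endo iota x i sigma delta /\
    forall r, r != 0 -> var_coef_comm iota x i r (sigma r).
Proof.
move=> pbw; have [_ _ coef _] := pbw; have free1 := skew_PBW_free1 pbw (i := i).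
have ex r : exists p : R * R, x i * iota r = iota p.1 * x i + iota p.2 /\
    (r != 0 -> p.1 != 0).
  have [->|rN0] := eqVneq r 0.
    by exists (0, 0); rewrite /= rmorph0 mulr0 mul0r addr0.
  have [c [cN0 [d dE]]] := coef i r rN0.
  by exists (c, d); rewrite /= -dE addrC subrK.
have [f fP] := choice ex.
pose s r := (f r).1; pose d r := (f r).2.
have E r : x i * iota r = iota (s r) * x i + iota (d r) by case: (fP r).
have sN0 r : r != 0 -> s r != 0 by case: (fP r).
have addE r t : s (r + t) = s r + s t /\ d (r + t) = d r + d t.
  by apply: free1; rewrite -E !rmorphD mulrDr mulrDl !E addrACA.
have oneE : s 1 = 1 /\ d 1 = 0.
  by apply: free1; rewrite -E !rmorph1 rmorph0 mulr1 mul1r addr0.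
have mulE r t : s (r * t) = s r * s t /\ d (r * t) = s r * d t + d r * t.
  apply: free1; rewrite -E rmorphD !rmorphM mulrA E mulrDl -[_ * x i * _]mulrA E.
  by rewrite mulrDr !mulrA addrA.
have s0 : s 0 = 0.
  by apply: (addrI (s 0)); rewrite -(addE 0 0).1 !addr0.
have sB : {morph s : r t / r - t}.
  move=> r t; apply: (addIr (s t)); rewrite -(addE _ _).1.
  by rewrite !subrK.
have sM : monoid_morphism s by split; [case: oneE | move=> r t; case: (mulE r t)].
pose hA := GRing.isZmodMorphism.Build R R s sB.
pose hM := GRing.isMonoidMorphism.Build R R s sM.
pose sigma : {rmorphism R -> R} := HB.pack s hA hM.
exists sigma, d; split.
  split=> //.
  - move=> r t rt; apply/eqP; rewrite -subr_eq0; apply: contraT => /sN0.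
    by rewrite sB; move: rt; rewrite /= => ->; rewrite subrr eqxx.
  - by split=> r t; [case: (addE r t) | case: (mulE r t)].
move=> r /sN0 sr; split=> //; exists (d r); by rewrite E addrAC subrr add0r.
Qed.

(* Main.v *)
Require Import Defs.
From mathcomp Require Import all_boot all_algebra.
From mathcomp Require Import boolp.

(** The relations let one rewrite an element of [A] as a left [R]-combination of
    words in the [x_i], and modulo shorter words the [x_i] commute with one
    another up to invertible coefficients and pass through [R] by the
    automorphisms [sigma_i].  Words are compared by degree, then
    lexicographically by their letter counts, which is compatible with left
    multiplication by each [x_i].  For a left ideal [I] of [A] and a word [w],
    the [r] such that [w * r] is the leading term of an element of [I] form a
    left ideal of [R], which depends only on the letter counts of [w] and grows
    when [w] gets longer.  Along an ascending chain these ideals thus form a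
    monotone family indexed by [N * N^n] in a left Noetherian ring; it becomes
    constant in the first index, uniformly in the others, and two nested left
    ideals of [A] with the same leading coefficients are equal, by well-founded
    induction on the leading word. *)

Set Implicit Arguments.
Unset Strict Implicit.
Unset Printing Implicit Defensive.
Import GRing.Theory.
Local Open Scope ring_scope.

(** * Stabilization of monotone families of left ideals indexed by words *)

Lemma monotone_ideals_stabilize (R : pzRingType) (T : eqType) (s : seq T)
    (L : nat -> seq T -> R -> Prop) :
  left_noetherian R ->
  (forall k w, left_ideal (L k w)) ->
  (forall k w a, L k w a -> L k.+1 w a) ->
  (forall k i w a, L k w a -> L k (i :: w) a) ->
  (forall k v w a, perm_eq v w -> L k v a -> L k w a) ->
  exists N, forall k w a, (N <= k)%N -> {subset w <= s} ->
    L k w a -> L N w a.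
Proof.
(* Induction on the alphabet: over the empty one only the empty word is left, hence a single
   chain. *)
move=> noeth; elim: s L => [|i s IHs] L idL monoL consL permL.
  have [N NP] := noeth (fun k => L k [::]) (idL^~ [::]) (monoL^~ [::]).
  exists N => k [|j w] a Nk ws; first by move/(NP k Nk a).
  by have := ws j (mem_head _ _).
have homoL k l w a : (k <= l)%N -> L k w a -> L l w a.
  by move/subnK<-; elim: (l - k)%N => // m IHm /IHm; apply: monoL.
have nseqL k l m w a : (l <= m)%N -> L k (nseq l i ++ w) a ->
    L k (nseq m i ++ w) a.
  by move/subnK<-; elim: (m - l)%N => // p IHp /IHp; apply: consL.
have shiftL m k j w a : L k (nseq m i ++ w) a -> L k (nseq m i ++ j :: w) a.
  move/(consL k j); apply: permL.
  by rewrite -cat1s perm_catCA.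
have permcat (u v w : seq T) : perm_eq v w -> perm_eq (u ++ v) (u ++ w).
  by rewrite perm_cat2l.
(* On the diagonal, where the number of letters [i] equals the chain index, the
   induction hypothesis handles all large numbers of letters [i] at once; each
   of the finitely many smaller numbers is then handled separately. *)
have [N NP] : exists N, forall k w a, (N <= k)%N -> {subset w <= s} ->
    L k (nseq k i ++ w) a -> L N (nseq N i ++ w) a.
  apply: (IHs (fun k w => L k (nseq k i ++ w))) => // [k w a|k j w a|k v w a].
  - by move/monoL; apply: nseqL.
  - exact: shiftL.
  - by move/(permcat (nseq k i)); apply: permL.
have [M MP] : exists M, forall m, (m < N)%N -> forall k w a, (M <= k)%N ->
    {subset w <= s} -> L k (nseq m i ++ w) a -> L M (nseq m i ++ w) a.
  elim: (N) => [|N' [M MP]]; first by exists 0%N.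
  have [M' MP'] : exists M, forall k w a, (M <= k)%N ->
      {subset w <= s} -> L k (nseq N' i ++ w) a -> L M (nseq N' i ++ w) a.
    apply: (IHs (fun k w => L k (nseq N' i ++ w))) => // [k w a|k j w a|k v w a].
    - exact: monoL.
    - exact: shiftL.
    - by move/(permcat (nseq N' i)); apply: permL.
  exists (maxn M M') => m; rewrite ltnS leq_eqVlt => /orP[/eqP->|mN] k w a.
    rewrite geq_max => /andP[_ Mk] ws /(MP' _ _ _ Mk ws).
    by apply: homoL; rewrite leq_maxr.
  rewrite geq_max => /andP[Mk _] ws /(MP _ mN _ _ _ Mk ws).
  by apply: homoL; rewrite leq_maxl.
exists (maxn M N) => k w a; rewrite geq_max => /andP[Mk Nk] ws Lkw.
(* Invariance under permutation gathers the letters [i] in front of a word over [s]. *)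
pose m := count_mem i w; pose w' := [seq j <- w | j != i].
have ww' : perm_eq w (nseq m i ++ w').
  have -> : nseq m i = filter (pred1 i) w.
    by have /all_pred1P-> := filter_all (pred1 i) w; rewrite size_filter.
  by rewrite perm_sym; apply: permEl (perm_filterC _ _).
have w's : {subset w' <= s}.
  move=> j; rewrite mem_filter => /andP[/negbTE ji /ws].
  by rewrite inE ji.
have {}Lkw := permL _ _ _ _ ww' Lkw.
apply: (permL _ (nseq m i ++ w')); first by rewrite perm_sym.
have [mN|Nm] := ltnP m N.
  by apply: homoL (MP _ mN _ _ _ Mk w's Lkw); rewrite leq_maxl.
apply: (homoL _ _ _ _ (leq_maxr M N)); apply: (nseqL _ _ _ _ _ Nm).
(* Raising both the chain index and the number of letters [i] to [maxn k m] reaches the diagonal. *)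
apply: (NP (maxn k m)) => //; first by rewrite leq_max Nk.
apply: (nseqL _ _ _ _ _ (leq_maxr k m)).
by apply: homoL Lkw; rewrite leq_maxl.
Qed.

(** * The degree-lexicographic order on words *)

Section DegreeLexicographicOrder.
Variable n : nat.
Implicit Types v w u : seq 'I_n.

Definition lex_lt v w :=
  [exists i, (count_mem i v < count_mem i w)%N &&
    [forall j : 'I_n, (j < i)%N ==> (count_mem j v == count_mem j w)]].

Definition deglex_lt v w :=
  (size v < size w)%N || (size v == size w) && lex_lt v w.

Lemma lex_ltP v w :
  reflect (exists2 i, (count_mem i v < count_mem i w)%N &
    forall j : 'I_n, (j < i)%N -> count_mem j v = count_mem j w) (lex_lt v w).
Proof.
apply: (iffP existsP) => [[i /andP[lti /forallP eqi]]|[i lti eqi]]; exists i => //.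
  by move=> j ji; apply/eqP; apply: implyP (eqi j) ji.
by rewrite lti; apply/forallP => j; apply/implyP => /eqi ->.
Qed.

Lemma lex_lt_irr w : lex_lt w w = false.
Proof. by apply/lex_ltP => -[i]; rewrite ltnn. Qed.

Lemma lex_lt_trans u v w : lex_lt u v -> lex_lt v w -> lex_lt u w.
Proof.
move=> /lex_ltP[i lti eqi] /lex_ltP[j ltj eqj]; apply/lex_ltP.
have [ij|ji|ij] := ltngtP i j.
- exists i => [|k ki]; first by rewrite -eqj.
  by rewrite eqi // eqj // (ltn_trans ki).
- exists j => [|k kj]; first by rewrite eqi.
  by rewrite eqi ?eqj // (ltn_trans kj).
- have {}ij := val_inj ij; subst j; exists i; first exact: ltn_trans lti ltj.
  by move=> k ki; rewrite eqi ?eqj.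
Qed.

Lemma lex_lt_total v w : [|| lex_lt v w, lex_lt w v | perm_eq v w].
Proof.
have [/existsP[i0 di0]|] := boolP [exists i, count_mem i v != count_mem i w].
  (* The least letter whose counts differ decides the comparison. *)
  case: (@arg_minnP _ i0 (fun i => count_mem i v != count_mem i w)
    (@nat_of_ord n)) => // i di imin.
  have eqi (j : 'I_n) : (j < i)%N -> count_mem j v = count_mem j w.
    by rewrite ltnNge => ij; apply/eqP; apply: contraNT ij; apply: imin.
  have [lti|lti|eqi'] := ltngtP (count_mem i v) (count_mem i w).
  - by apply/or3P; apply: Or31; apply/lex_ltP; exists i.
  - by apply/or3P; apply: Or32; apply/lex_ltP; exists i => // j /eqi.
  - by rewrite eqi' eqxx in di.
rewrite negb_exists => /forallP eqvw; apply/or3P; apply: Or33.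
by apply/allP => i _; move: (eqvw i); rewrite negbK.
Qed.

Lemma deglex_lt_trans u v w : deglex_lt u v -> deglex_lt v w -> deglex_lt u w.
Proof.
move=> /orP[uv|/andP[/eqP uv luv]] /orP[vw|/andP[/eqP vw lvw]]; apply/orP.
- by left; apply: ltn_trans uv vw.
- by left; rewrite -vw.
- by left; rewrite uv.
- by right; rewrite uv vw eqxx (lex_lt_trans luv).
Qed.

Lemma deglex_lt_total v w : [|| deglex_lt v w, deglex_lt w v | perm_eq v w].
Proof.
rewrite /deglex_lt; have [//|_|_] /= := ltngtP (size v) (size w); first by [].
exact: lex_lt_total.
Qed.

Lemma deglex_lt_cons i v w : deglex_lt v w -> deglex_lt (i :: v) (i :: w).
Proof.
move=> /orP[vw|/andP[/eqP vw /lex_ltP[j ltj eqj]]]; rewrite /deglex_lt /= ltnS.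
  by rewrite vw.
rewrite vw eqxx; apply/orP; right; apply/lex_ltP; exists j => /= [|k /eqj->//].
by rewrite ltn_add2l.
Qed.

(** Serves the terms in [delta], where multiplication by [x i] leaves the word as it was. *)
Lemma deglex_lt_consr i v w : deglex_lt v w -> deglex_lt v (i :: w).
Proof.
move=> /orP[vw|/andP[/eqP vw _]]; rewrite /deglex_lt /=; last by rewrite vw ltnSn.
by rewrite ltnW.
Qed.

Lemma deglex_lt_permr v w w' : perm_eq w w' -> deglex_lt v w -> deglex_lt v w'.
Proof.
move=> ww'; rewrite /deglex_lt (perm_size ww') => /orP[->//|/andP[-> vw]].
apply/orP; right; have [i lti eqi] := lex_ltP _ _ vw; apply/lex_ltP.
by exists i => [|j /eqi]; rewrite -(permP ww').
Qed.

Lemma deglex_lt_size v w : (size v < size w)%N -> deglex_lt v w.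
Proof. by rewrite /deglex_lt => ->. Qed.

Lemma deglex_lt_ind (P : seq 'I_n -> Prop) :
  (forall w, (forall v, deglex_lt v w -> P v) -> P w) -> forall w, P w.
Proof.
move=> step w; have [d] := ubnP (size w); elim: d w => // d IHd w.
(* Finitely many words share a size, so the number of lexicographically smaller ones is a measure
   for the inner induction. *)
pose rank u := #|[set t : (size w).-tuple 'I_n | lex_lt t u]|.
have rank_lt u v : size u = size w -> lex_lt u v -> (rank u < rank v)%N.
  move=> uw uv; apply: proper_card; apply/properP; split.
    by apply/subsetP => t; rewrite !inE => tu; apply: lex_lt_trans tu uv.
  by have /eqP uw' := uw; exists (Tuple uw'); rewrite !inE //= lex_lt_irr.
rewrite ltnS => wd.
suff: forall m u, (rank u < m)%N -> size u = size w -> P u by apply.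
elim=> // m IHm u rum uw; apply: step => v /orP[vu|/andP[/eqP vu lvu]].
  by apply: IHd; rewrite (leq_trans vu) // uw.
apply: IHm; last by rewrite vu.
by rewrite -ltnS; apply: leq_trans rum; rewrite ltnS; apply: rank_lt; rewrite ?vu.
Qed.

End DegreeLexicographicOrder.

(** * Combinations of words and commutation modulo shorter words *)

Section WordSpan.
Variables (R A : pzRingType) (iota : {rmorphism R -> A}).
Variables (n : nat) (x : 'I_n -> A).
Implicit Types (u v w : seq 'I_n) (P Q : seq 'I_n -> Prop).

Definition word w : A := \prod_(i <- w) x i.

Lemma word_nil : word [::] = 1. Proof. exact: big_nil. Qed.

Lemma word_cons i w : word (i :: w) = x i * word w.
Proof. exact: big_cons. Qed.

(** Words need not be linearly independent, so only the existence of an expression is recorded. *)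
Inductive span P : A -> Prop :=
| span_nil : span P 0
| span_cons r w a : P w -> span P a -> span P (iota r * word w + a).

Lemma spanZword P r w : P w -> span P (iota r * word w).
Proof. by move=> Pw; rewrite -[_ * _]addr0; apply: span_cons => //; apply: span_nil. Qed.

Lemma spanD P a b : span P a -> span P b -> span P (a + b).
Proof.
move=> sa sb; elim: sa => [|r w {}a Pw _ IHa]; first by rewrite add0r.
by rewrite -addrA; apply: span_cons.
Qed.

Lemma spanZ P r a : span P a -> span P (iota r * a).
Proof.
elim=> [|s w {}a Pw _ IHa]; first by rewrite mulr0; apply: span_nil.
by rewrite mulrDr mulrA -rmorphM; apply: span_cons.
Qed.

Lemma spanN P a : span P a -> span P (- a).
Proof. by move=> /(spanZ (- 1)); rewrite rmorphN rmorph1 mulN1r. Qed.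

Lemma spanB P a b : span P a -> span P b -> span P (a - b).
Proof. by move=> sa /spanN; apply: spanD. Qed.

Lemma span_sub P Q a : (forall w, P w -> Q w) -> span P a -> span Q a.
Proof.
move=> PQ; elim=> [|r w {}a Pw _ IHa]; first exact: span_nil.
by apply: span_cons => //; apply: PQ.
Qed.

Lemma span_sum (I : Type) (s : seq I) P (F : I -> A) :
  (forall i, span P (F i)) -> span P (\sum_(i <- s) F i).
Proof.
move=> sF; elim: s => [|i s IHs]; first by rewrite big_nil; apply: span_nil.
by rewrite big_cons; apply: spanD.
Qed.

Lemma monomial_word alpha :
  monomial x alpha = word (flatten [seq nseq (alpha i) i | i <- index_enum 'I_n]).
Proof.
rewrite /monomial /word big_flatten big_map; apply: eq_bigr => i _.
by rewrite big_nseq -Monoid.iteropE.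
Qed.

Lemma left_basis_span a :
  left_basis iota (monomial x) -> span (fun=> True) a.
Proof.
case=> /(_ a)[s [c ->]] _; apply: span_sum => alpha.
by rewrite monomial_word; apply: spanZword.
Qed.

Definition low d : A -> Prop := span (fun w => (size w < d)%N).

Variables (sigma : 'I_n -> R -> R) (delta : 'I_n -> R -> R).
Hypothesis xiota : forall i r,
  x i * iota r = iota (sigma i r) * x i + iota (delta i r).
Hypothesis sigma_surj : forall i s, exists r, sigma i r = s.
Hypothesis swap : forall i j, exists c,
  low 2 (x j * x i - iota c * (x i * x j)).

Lemma span_mulx P Q i a : (forall w, P w -> Q w /\ Q (i :: w)) ->
  span P a -> span Q (x i * a).
Proof.
move=> PQ; elim=> [|r w {}a Pw _ IHa]; first by rewrite mulr0; apply: span_nil.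
have [Qw Qiw] := PQ w Pw.
rewrite mulrDr mulrA xiota mulrDl -mulrA -word_cons.
by do 2![apply: spanD => //]; apply: spanZword.
Qed.

Lemma low_mulx d i a : low d a -> low d.+1 (x i * a).
Proof. by apply: span_mulx => w /= wd; split; [apply: leqW|]. Qed.

(** Moving [x i] past [s] costs the error [delta i s] times [w], which is one letter shorter than
    [i :: w]. *)
Lemma low_coef_cons i w r s :
  low (size w) (word w * iota r - iota s * word w) ->
  low (size (i :: w)) (word (i :: w) * iota r - iota (sigma i s) * word (i :: w)).
Proof.
move=> /(low_mulx i); rewrite mulrBr !word_cons -mulrA => l.
rewrite -[_ - _](addrNK (iota (delta i s) * word w)).
apply: spanD; last exact: spanZword (ltnSn _).
by rewrite -addrA -opprD !mulrA -mulrDl -xiota -!mulrA.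
Qed.

Lemma word_coef w r : exists s, low (size w) (word w * iota r - iota s * word w).
Proof.
elim: w => [|i w [s IHw]].
  by exists r; rewrite word_nil mulr1 mul1r subrr; apply: span_nil.
by exists (sigma i s); apply: low_coef_cons.
Qed.

(** Surjectivity of each [sigma i] allows a left coefficient to be pulled back through the letters
    one by one. *)
Lemma coef_word w s : exists r, low (size w) (word w * iota r - iota s * word w).
Proof.
elim: w s => [|i w IHw] s.
  by exists s; rewrite word_nil mulr1 mul1r subrr; apply: span_nil.
have [t <-] := sigma_surj i s; have [r lr] := IHw t.
by exists r; apply: low_coef_cons.
Qed.

Lemma low_mulr d a r : low d a -> low d (a * iota r).
Proof.
elim=> [|s w {}a wd _ IHa]; first by rewrite mul0r; apply: span_nil.
rewrite mulrDl -mulrA; apply: spanD => //; apply: spanZ.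
have [t lt] := word_coef w r.
rewrite -[_ * _](addrNK (iota t * word w)); apply: spanD; last exact: spanZword.
by apply: span_sub lt => v vw; apply: ltn_trans vw wd.
Qed.

Lemma low_mulwordr d w a : low d a -> low (d + size w) (a * word w).
Proof.
elim=> [|s v {}a vd _ IHa]; first by rewrite mul0r; apply: span_nil.
rewrite mulrDl -mulrA; apply: spanD => //.
have -> : word v * word w = word (v ++ w) by rewrite /word big_cat.
by apply: spanZword; rewrite size_cat ltn_add2r.
Qed.

(* No unit is recorded: as permutations can be undone, the statement already
   gives a multiple in each direction. *)
Lemma word_perm v w : perm_eq v w ->
  exists c, low (size w) (word w - iota c * word v).
Proof.
have refl w' : exists c, low (size w') (word w' - iota c * word w').
  by exists 1; rewrite rmorph1 mul1r subrr; apply: span_nil.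
have trans v' u w' : size u = size w' ->
    (exists c, low (size w') (word w' - iota c * word u)) ->
    (exists c, low (size u) (word u - iota c * word v')) ->
    exists c, low (size w') (word w' - iota c * word v').
  move=> uw [c lc] [d ld]; exists (c * d).
  rewrite -(subrKA (iota c * word u)) rmorphM -mulrA -mulrBr.
  by apply: spanD => //; apply: spanZ; rewrite -uw.
have cons i v' w' : (exists c, low (size w') (word w' - iota c * word v')) ->
    size v' = size w' ->
    exists c, low (size (i :: w')) (word (i :: w') - iota c * word (i :: v')).
  move=> [c /(low_mulx i) lc] vw; exists (sigma i c).
  rewrite -[_ - _](addrNK (iota (delta i c) * word v')).
  apply: spanD; last by apply: spanZword; rewrite vw /=.
  rewrite -addrA -opprD !word_cons !mulrA -mulrDl -xiota.
  by rewrite -mulrA -mulrBr.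
have swapw i j w' : exists c, low (size [:: j, i & w'])
    (word [:: j, i & w'] - iota c * word [:: i, j & w']).
  have [c lc] := swap i j; exists c.
  rewrite !word_cons [x j * _]mulrA [x i * _]mulrA mulrA -mulrBl.
  by have := low_mulwordr w' lc.
elim: w v => [|j w IHw] v vw.
  by rewrite (perm_nilP vw); apply: refl.
have jv : j \in v by rewrite (perm_mem vw) mem_head.
case/splitPr: jv vw => a b abw.
have {}abw : perm_eq (a ++ b) w.
  by rewrite -(perm_cons j) (perm_trans _ abw) // perm_sym -cat1s perm_catCA.
(* The head [j] of the target is brought to the front of the source by adjacent swaps; the tails are
   matched by induction. *)
apply: (@trans _ (j :: a ++ b)) => [/=||].
- by rewrite (perm_size abw).
- by apply: cons (IHw _ abw) _; rewrite (perm_size abw).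
elim: a {abw} => [|i a IHa]; first exact: refl.
apply: (@trans _ (i :: j :: a ++ b)) => //; first exact: swapw.
by apply: (cons i (a ++ j :: b) (j :: a ++ b)); rewrite //= !size_cat addnS.
Qed.

(** * Leading words and leading coefficients *)

Definition below w : A -> Prop := span (fun v => deglex_lt v w).

(** Terms are added one at a time, and permuted words are merged by [word_perm]. Cancellation need
    not be detected: [t] may be 0. *)
Lemma span_leading P a : span P a ->
  a = 0 \/ exists v t, P v /\ below v (a - iota t * word v).
Proof.
elim=> [|r w {}a Pw _ [->|[v [t [Pv lv]]]]]; first by left.
  right; exists w, r; split=> //.
  by rewrite addr0 subrr; apply: span_nil.
right; have /or3P[wv|vw|wv] := deglex_lt_total w v.
- exists v, t; split=> //; rewrite -addrA; apply: spanD => //.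
  exact: spanZword.
- exists w, r; split=> //; rewrite addrAC subrr add0r.
  rewrite -[a](addrNK (iota t * word v)); apply: spanD; last exact: spanZword.
  by apply: span_sub lv => u uv; apply: deglex_lt_trans uv vw.
- have [c lc] : exists c, low (size w) (word w - iota c * word v).
    by apply: word_perm; rewrite perm_sym.
  exists v, (r * c + t); split=> //.
  rewrite rmorphD mulrDl opprD addrACA; apply: spanD => //.
  rewrite rmorphM -mulrA -mulrBr; apply: spanZ; apply: span_sub lc => u uw.
  by apply: deglex_lt_size; rewrite -(perm_size wv).
Qed.

(* With the coefficient on the right of the word, the leading coefficients form
   left ideals that grow with the word; with it on the left they would be
   twisted by the automorphisms. *)
Definition right_lead_coef (I : A -> Prop) w (r : R) : Prop :=
  exists2 a, I a & below w (a - word w * iota r).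

Lemma low_deglex w a : low (size w) a -> below w a.
Proof. by apply: span_sub => v; apply: deglex_lt_size. Qed.

Lemma right_lead_coef_ideal I w : left_ideal I -> left_ideal (right_lead_coef I w).
Proof.
case=> I0 ID IM; split.
- by exists 0 => //; rewrite rmorph0 mulr0 subrr; apply: span_nil.
- move=> r s [a Ia la] [b Ib lb]; exists (a + b); first exact: ID.
  by rewrite rmorphD mulrDr opprD addrACA; apply: spanD.
(* Since [word w * iota s] is [iota t * word w] up to shorter words, multiplying [a] by [iota t] on
   the left multiplies its right coefficient by [s]. *)
- move=> s r [a Ia la]; have [t lt] := word_coef w s.
  exists (iota t * a); first exact: IM.
  rewrite -(subrKA (iota t * (word w * iota r))) -mulrBr.
  apply: spanD; first exact: spanZ.
  rewrite rmorphM !mulrA -mulrBl -opprB mulNr; apply/spanN/low_deglex.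
  exact: low_mulr.
Qed.

Lemma right_lead_coef_cons I i w r :
  left_ideal I -> right_lead_coef I w r -> right_lead_coef I (i :: w) r.
Proof.
case=> _ _ IM [a Ia la]; exists (x i * a); first exact: IM.
rewrite word_cons -mulrA -mulrBr; apply: span_mulx la => v vw.
by split; [apply: deglex_lt_consr | apply: deglex_lt_cons].
Qed.

Lemma right_lead_coef_perm I v w r :
  left_ideal I -> perm_eq v w -> right_lead_coef I v r -> right_lead_coef I w r.
Proof.
case=> _ _ IM vw [a Ia la]; have [c lc] := word_perm vw.
exists (iota c * a); first exact: IM.
rewrite -(subrKA (iota c * (word v * iota r))) -mulrBr.
apply: spanD.
  by apply/spanZ/(span_sub _ la) => u; apply: deglex_lt_permr.
rewrite mulrA -mulrBl -opprB mulNr; apply/spanN/low_deglex.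
exact: low_mulr.
Qed.

Lemma right_lead_coef_eq (I J : A -> Prop) : left_ideal I -> left_ideal J ->
  (forall a, I a -> J a) ->
  (forall w r, right_lead_coef J w r -> right_lead_coef I w r) ->
  (forall a, span (fun=> True) a) -> forall a, J a -> I a.
Proof.
move=> idI idJ IJ leadJI spanT.
have [[I0 ID _] [_ JD JM]] := (idI, idJ).
(* A general [P] serves twice: for the words below [w] in the induction, and for all words at the
   end. *)
have step P a : (forall v, P v -> forall b, below v b -> J b -> I b) ->
    span P a -> J a -> I a.
  move=> IHP Pa Ja; have [->//|[v [t [Pv lv]]]] := span_leading Pa.
  have [r lr] := coef_word v t.
  have avr : below v (a - word v * iota r).
    rewrite -(subrKA (iota t * word v)); apply: spanD => //.
    by rewrite -opprB; apply/spanN/low_deglex.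
  (* [b] has the same leading term as [a], so [a - b] lies in [J] and below [v]. *)
  have [b Ib bvr] := leadJI v r (ex_intro2 _ _ a Ja avr).
  rewrite -(subrK b a); apply: ID => //; apply: (IHP v) => //.
    by rewrite -(subrKA (word v * iota r)) -(opprB b); apply: spanB.
  by rewrite -mulN1r; apply: JD => //; apply/JM/IJ.
move=> a; apply: (step (fun=> True)) => // w _.
elim/deglex_lt_ind: w => w IHw b; exact: step IHw.
Qed.

Lemma word_span_noetherian :
  left_noetherian R -> (forall a, span (fun=> True) a) -> left_noetherian A.
Proof.
move=> noethR spanT I idI monoI.
have homoI k l a : (k <= l)%N -> I k a -> I l a.
  by move/subnK<-; elim: (l - k)%N => // m IHm /IHm; apply: monoI.
have [N NP] : exists N, forall k w a, (N <= k)%N -> {subset w <= enum 'I_n} ->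
    right_lead_coef (I k) w a -> right_lead_coef (I N) w a.
  apply: monotone_ideals_stabilize => //.
  - by move=> k w; apply: right_lead_coef_ideal.
  - by move=> k w r [a Ia la]; exists a => //; apply: monoI.
  - by move=> k i w a; apply: right_lead_coef_cons.
  - by move=> k v w a; apply: right_lead_coef_perm.
exists N => k Nk a; split; last exact: homoI.
apply: right_lead_coef_eq => // [b|w r]; first exact: homoI.
by apply: NP => // i _; rewrite mem_enum.
Qed.

End WordSpan.

(** * Application to bijective skew PBW extensions *)

Lemma bijective_skew_PBW_swap (R A : pzRingType) (iota : {rmorphism R -> A})
    (n : nat) (x : 'I_n -> A) (i j : 'I_n) :
  bijective_skew_PBW iota x ->
  exists c, low iota x 2 (x j * x i - iota c * (x i * x j)).
Proof.
case=> _ _ coef.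
have lin d e : low iota x 2 (iota d + \sum_(k < n) iota (e k) * x k).
  apply: spanD; first by rewrite -[iota d]mulr1 -(word_nil x); apply: spanZword.
  apply: span_sum => k.
  have -> : x k = word x [:: k] by rewrite word_cons word_nil mulr1.
  exact: spanZword.
have [ij|ji|ij] := ltngtP i j.
- have [c [[_ [d [e E]]] _]] := coef i j ij.
  by exists c; rewrite mulrA E.
(* The relation is given for [j < i] only in the opposite direction; the inverse [c'] solves it for
   [x j * x i]. *)
- have [c [[_ [d [e E]]] [c' [_ c'c]]]] := coef j i ji; exists c'.
  have -> : x j * x i - iota c' * (x i * x j) =
      - (iota c' * (x i * x j - iota c * x j * x i)).
    by rewrite mulrBr opprB !mulrA -rmorphM c'c rmorph1 mul1r.
  by rewrite E; apply/spanN/spanZ/lin.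
- have {}ij := val_inj ij; subst j.
  by exists 1; rewrite rmorph1 mul1r subrr; apply: span_nil.
Qed.

Theorem corollary2p4 (R A : pzRingType) (iota : {rmorphism R -> A})
    (n : nat) (x : 'I_n -> A) (hA : bijective_skew_PBW iota x)
    (hR : left_noetherian R) : left_noetherian A.
Proof.
have [[_ basis _ _] endo _] := hA.
have sd_ex i : exists p : (R -> R) * (R -> R),
    (forall r, x i * iota r = iota (p.1 r) * x i + iota (p.2 r)) /\
    (forall s, exists r, p.1 r = s).
  have [s [d [[_ _ E] [t _ tK]]]] := endo i.
  by exists (s : R -> R, d); split=> //= r; exists (t r).
have [sd sdP] := choice sd_ex.
apply: (@word_span_noetherian R A iota n x (fun i => (sd i).1)
  (fun i => (sd i).2)) => //.
- by move=> i r; case: (sdP i).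
- by move=> i; case: (sdP i).
- by move=> i j; apply: bijective_skew_PBW_swap hA.
- by move=> a; apply: left_basis_span.
Qed.
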